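(* Let $h(n)$, $n\ge 1$, be the integers defined by $\sum_{n=1}^{\infty} h(n)q^n=\sum_{n=1}^{\infty}\frac{(-1)^{n+1}q^{n(n+1)/2}}{1-q^n}$. If $n=p_1^2p_2^2$, where $p_1$ and $p_2$ are odd primes with $p_1<p_2<\sqrt{2}\,p_1$, then $h(n)=3$.
   Context: The identity defining $h(n)$ is an identity of formal power series in $q$, with each $\frac{1}{1-q^n}$ expanded as $\sum_{m\ge 0}q^{nm}$. *)

(* Defs.v *)
From mathcomp Require Import all_boot all_order all_algebra.
From mathcomp Require Import reals.

Set Implicit Arguments.
Unset Strict Implicit.
Unset Printing Implicit Defensive.

Import Order.TTheory GRing.Theory Num.Theory.
Local Open Scope ring_scope.

(* A formal power series in q over the integers is its coefficient sequence:
   [a k] is the coefficient of q^k. *)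
Definition fps := nat -> int.

(* c q^k *)
Definition fps_monom (c : int) (k : nat) : fps :=
  fun i => if i == k then c else 0.

Definition fps_mul (a b : fps) : fps :=
  fun k => \sum_(i < k.+1) a i * b (k - i)%N.

(* The infinite sum of F n over n >= s converges to S in the q-adic topology:
   each coefficient of the partial sums is eventually that of S. *)
Definition fps_has_sum (s : nat) (F : nat -> fps) (S : fps) : Prop :=
  forall k, exists N : nat, forall M : nat, (N <= M)%N ->
    \sum_(s <= n < M) F n k = S k.

(* 1 / (1 - q^n) for n >= 1, see [fps_geom_has_sum] and [fps_geom_inv];
   the value at n = 0 is meaningless. *)
Definition fps_geom (n : nat) : fps := fun k => (n %| k)%N%:R.

Definition h_term (n : nat) : fps :=
  fps_mul (fps_monom ((-1) ^+ n.+1) ((n * n.+1) %/ 2)%N) (fps_geom n).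

(* The value h 0 is unconstrained. *)
Definition h_identity (h : nat -> int) : Prop :=
  exists S : fps,
    fps_has_sum 1 (fun n => fps_monom (h n) n) S /\ fps_has_sum 1 h_term S.

Lemma fps_geom_has_sum n : (0 < n)%N ->
  fps_has_sum 0 (fun m => fps_monom 1 (n * m)%N) (fps_geom n).
Proof.
move=> n0 k; exists k.+1 => M kM; rewrite /fps_geom /fps_monom.
have [/dvdnP[m kE]|ndv] := boolP (n %| k)%N; last first.
  rewrite big1 // => m _; case: eqP => // kE.
  by rewrite kE dvdn_mulr in ndv.
have mM : (m < M)%N by apply: leq_trans kM; rewrite kE ltnS leq_pmulr.
rewrite big_mkord (bigD1 (Ordinal mM)) //= kE mulnC eqxx big1 ?addr0 // => i.
rewrite -val_eqE /= eqn_pmul2l // => ne.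
by case: eqP => // mi; rewrite mi eqxx in ne.
Qed.

Lemma fps_mul_monom c j (b : fps) k :
  fps_mul (fps_monom c j) b k = if (j <= k)%N then c * b (k - j)%N else 0.
Proof.
rewrite /fps_mul /fps_monom; case: leqP => jk; last first.
  rewrite big1 // => i _; case: eqP => [ij|]; last by rewrite mul0r.
  by have := ltn_ord i; rewrite ij ltnS leqNgt jk.
have jk' : (j < k.+1)%N by [].
rewrite (bigD1 (Ordinal jk')) //= eqxx big1 ?addr0 // => i.
by rewrite -val_eqE /= => /negbTE ->; rewrite mul0r.
Qed.

Lemma fps_geom_inv n : (0 < n)%N ->
  fps_mul (fun k => fps_monom 1 0 k - fps_monom 1 n k) (fps_geom n)
    =1 fps_monom 1 0.
Proof.
move=> n0 k; rewrite /fps_mul.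
under eq_bigr do rewrite mulrBl.
rewrite sumrB; have := fps_mul_monom 1 0 (fps_geom n) k.
rewrite /fps_mul => ->; have := fps_mul_monom 1 n (fps_geom n) k.
rewrite /fps_mul => ->; rewrite leq0n !mul1r subn0 /fps_geom /fps_monom.
case: leqP => nk; first rewrite dvdn_subl // subrr.
  by case: eqP => // k0; rewrite k0 leqNgt n0 in nk.
rewrite subr0; case: eqP => [->|/eqP k0]; first by rewrite dvdn0.
by rewrite gtnNdvd // lt0n.
Qed.

Lemma fps_sum_monom (f : nat -> int) k M : (0 < k < M)%N ->
  \sum_(1 <= n < M) fps_monom (f n) n k = f k.
Proof.
move=> /andP[k0 kM]; rewrite (bigD1_seq k) ?mem_index_iota ?k0 ?iota_uniq //=.
rewrite {1}/fps_monom eqxx big1 ?addr0 // => i ik.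
by rewrite /fps_monom eq_sym (negbTE ik).
Qed.

Lemma h_identity_exists : exists h, h_identity h.
Proof.
exists (fun k => \sum_(1 <= n < k.+1) h_term n k).
exists (fun k => \sum_(1 <= n < k.+1) h_term n k).
split=> k; exists k.+1 => M kM.
  have [->|k0] := posnP k; last by rewrite fps_sum_monom ?k0.
  rewrite [RHS]big_geq // big_nat big1 // => i /andP[i0 _].
  by rewrite /fps_monom ltn_eqF.
rewrite (@big_cat_nat _ _ _ k.+1) //= -[RHS]addr0; congr (_ + _).
rewrite big_nat big1 // => i /andP[ki _].
rewrite /h_term fps_mul_monom leqNgt.
suff -> : (k < (i * i.+1) %/ 2)%N by [].
rewrite (leq_trans ki) // leq_divRL // leq_mul // ltnS.
exact: leq_ltn_trans ki.
Qed.

Lemma h_identity_unique h h' : h_identity h -> h_identity h' ->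
  forall n, (0 < n)%N -> h n = h' n.
Proof.
have coefE f S : fps_has_sum 1 (fun n => fps_monom (f n) n) S ->
    forall n, (0 < n)%N -> S n = f n.
  move=> fS n n0; have [N /(_ (maxn N n.+1) (leq_maxl _ _)) <-] := fS n.
  by rewrite fps_sum_monom // n0 leq_maxr.
move=> [S [hS tS]] [S' [hS' tS']] n n0.
rewrite -(coefE _ _ hS) // -(coefE _ _ hS') //.
have [N NS] := tS n; have [N' NS'] := tS' n.
by rewrite -(NS (maxn N N')) ?leq_maxl // -(NS' (maxn N N')) ?leq_maxr.
Qed.

(* Main.v *)
Require Import Defs.
From mathcomp Require Import all_boot all_order all_algebra.
From mathcomp Require Import reals.
From mathcomp Require Import zify.

(** The coefficient of [q^N] in the [m]-th term of the series is
    [(-1)^(m+1)] when [m] divides [N - m(m+1)/2 >= 0], and [0] otherwise.  For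
    odd [N], each sign sees exactly the divisors of [N] in some range:

    - [m] odd counts [+1] when [m] divides [N] and [m^2 < 2N], because then
      [m] divides [m(m+1)/2];
    - [m = 2k] counts [-1] when [k] divides [N] and [2k^2 < N], because
      [m(m+1)/2 = k(2k+1)] and the cofactor [N/k] is odd.

    The second range is contained in the first, so [h N] is the number of
    divisors [d] of [N] with [N/2 < d^2 < 2N] ([h_odd]).  When
    [N = p1^2 p2^2], the hypothesis [p2 < sqrt 2 * p1] says that
    [p2^2 < 2 p1^2], which puts [p1^2], [p1 p2] and [p2^2] in this window; the
    other six divisors [p1^a p2^b] fall outside since [2 < p1^2 < p2^2]. *)

Import Order.TTheory GRing.Theory Num.Theory.
Local Open Scope ring_scope.

Lemma h_partial_sum (h : nat -> int) (N : nat) : h_identity h -> (0 < N)%N ->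
  exists M0 : nat, forall M : nat, (M0 <= M)%N ->
    h N = \sum_(1 <= m < M) h_term m N.
Proof.
move=> [S [hS tS]] N0; have [M0 tE] := tS N; exists M0 => M /tE ->.
have [M1 hE] := hS N; rewrite -(hE (maxn M1 N.+1)) ?leq_maxl //.
by rewrite fps_sum_monom // N0 leq_maxr.
Qed.

Lemma h_term_odd (m N : nat) : odd m ->
  h_term m N = ((m %| N) && (m ^ 2 < 2 * N))%N%:R.
Proof.
move=> m_odd; have m0 := odd_gt0 m_odd.
have TE : ((m * m.+1) %/ 2 = m * uphalf m)%N.
  have -> : m.+1 = (2 * uphalf m)%N by lia.
  by rewrite mulnCA mulKn.
rewrite /h_term fps_mul_monom TE /fps_geom exprS -signr_odd m_odd mulrNN !mul1r.
case: (leqP (m * uphalf m) N) => leT.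
  rewrite dvdn_subl ?dvdn_mulr //.
  have [/dvdnP[q NE]|//] := boolP (m %| N)%N.
  rewrite NE [(m * _)%N]mulnC leq_pmul2r // in leT.
  have -> // : (m ^ 2 < 2 * N)%N by rewrite NE mulnA -mulnn ltn_pmul2r //; lia.
have [/dvdnP[q NE]|//] := boolP (m %| N)%N.
rewrite NE [(m * _)%N]mulnC ltn_pmul2r // in leT.
by rewrite NE mulnA -mulnn ltn_pmul2r //; case: ltnP => //; lia.
Qed.

Lemma h_term_even (k N : nat) : odd N -> (0 < k)%N ->
  h_term k.*2 N = - ((k %| N) && (2 * k ^ 2 < N))%N%:R.
Proof.
move=> N_odd k0.
have TE : ((k.*2 * k.*2.+1) %/ 2 = k.*2.+1 * k)%N.
  by rewrite -mul2n -mulnA mulKn // mulnC.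
rewrite /h_term fps_mul_monom TE /fps_geom exprS -signr_odd odd_double mulr1.
have [/dvdnP[q NE]|kN] := boolP (k %| N)%N; last first.
  case: (leqP _ N) => leT /=; last by rewrite oppr0.
  rewrite mulN1r; congr (- _%:R); apply/eqP; rewrite eqb0.
  apply: contra kN; rewrite -mul2n => /(dvdn_trans (dvdn_mull 2 (dvdnn k))).
  by rewrite mul2n dvdn_subl ?dvdn_mull.
have q_odd : odd q by move: N_odd; rewrite NE oddM => /andP[].
rewrite NE leq_pmul2r // -mulnn mulnA ltn_pmul2r // mul2n.
case: (leqP k.*2.+1 q) => ltq; last by rewrite oppr0.
by rewrite -mulnBl -{1}mul2n dvdn_pmul2r // dvdn2 oddB // oddS odd_double q_odd mulN1r.
Qed.

Lemma sum_odd_even (f : nat -> int) (L : nat) :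
  \sum_(1 <= m < L.*2.+1) f m =
  \sum_(1 <= m < L.*2.+1 | odd m) f m + \sum_(1 <= k < L.+1) f k.*2.
Proof.
elim: L => [|L IH]; first by rewrite !big_geq.
rewrite doubleS !(big_nat_recr L.*2.+2) //= !(big_nat_recr L.*2.+1) //= IH.
rewrite [in RHS]big_mkcond !(big_nat_recr L.*2.+2) // !(big_nat_recr L.*2.+1) //=.
rewrite -big_mkcond odd_double /= (big_nat_recr L.+1) //= doubleS addr0.
by rewrite -!addrA; congr (_ + _); rewrite addrCA.
Qed.

(** The two ranges of divisors in [h_term_odd] and [h_term_even] are nested,
    and [N] odd excludes the boundary case [2d^2 = N]; hence their difference
    is the window below. *)
Lemma h_odd (h : nat -> int) (N : nat) : h_identity h -> odd N ->
  h N = (size [seq d <- divisors N | N < 2 * d ^ 2 < 4 * N])%N%:R.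
Proof.
move=> hdef N_odd; have N0 := odd_gt0 N_odd.
have [M0 hE] := h_partial_sum h N hdef N0.
pose L := maxn M0 N.
have ltNL : (N < L.+1)%N by rewrite ltnS leq_maxr.
rewrite (hE L.*2.+1); last by rewrite /L; lia.
rewrite sum_odd_even.
have -> : \sum_(1 <= m < L.*2.+1 | odd m) h_term m N =
          \sum_(1 <= m < L.*2.+1) ((m %| N) && (m ^ 2 < 2 * N))%N%:R.
  rewrite [LHS]big_mkcond; apply: eq_bigr => m _.
  case: ifP => [/h_term_odd -> //|m_even].
  case: (boolP (m %| N)%N) => //= /dvdnP[q NE].
  by move: N_odd; rewrite NE oddM m_even andbF.
have -> : \sum_(1 <= k < L.+1) h_term k.*2 N =
          \sum_(1 <= k < L.+1) - ((k %| N) && (2 * k ^ 2 < N))%N%:R.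
  by apply: eq_big_nat => k /andP[k0 _]; rewrite h_term_even.
(* The first sum may be cut at [L >= N], beyond which nothing divides [N]. *)
rewrite (@big_cat_nat _ _ _ L.+1) //=; last by rewrite ltnS; lia.
rewrite [X in _ + X + _]big_nat [X in _ + X + _]big1 => [|m /andP[ltm _]];
  last by rewrite gtnNdvd // (leq_trans ltNL).
rewrite addr0 -big_split /=.
pose P d := (N < 2 * d ^ 2 < 4 * N)%N.
have eP d : ((d %| N) && (d ^ 2 < 2 * N))%N%:R -
            ((d %| N) && (2 * d ^ 2 < N))%N%:R
            = ((d %| N) && P d)%N%:R :> int.
  have neN : N != (2 * d ^ 2)%N.
    by apply: contraTneq N_odd => ->; rewrite oddM.
  have -> : P d = (d ^ 2 < 2 * N)%N && ~~ (2 * d ^ 2 < N)%N.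
    by rewrite /P ltn_neqAle neN -leqNgt andbC -[4%N]/(2 * 2)%N -mulnA ltn_pmul2l.
  have [lt2|_] := boolP (2 * d ^ 2 < N)%N; last by rewrite andbF subr0 andbT.
  have -> : (d ^ 2 < 2 * N)%N by lia.
  by rewrite andbF subrr.
under eq_bigr do rewrite eP.
rewrite -natr_sum; congr (_%:R).
transitivity (size [seq d <- index_iota 1 L.+1 | (d %| N)%N && P d]).
  by rewrite size_filter -sum1_count [RHS]big_mkcond; apply: eq_bigr => d _; case: (_ && _).
apply/perm_size/uniq_perm; rewrite ?filter_uniq ?iota_uniq ?divisors_uniq //.
move=> d; rewrite !mem_filter mem_index_iota -dvdn_divisors // -/(P d).
case: (boolP (d %| N)%N) => [dN|_]; last by rewrite andbF.
rewrite (dvdn_gt0 N0 dN) (leq_ltn_trans (dvdn_leq N0 dN) ltNL) /=.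
by rewrite !andbT.
Qed.

(** Take [a = gcd(d, m)]: the cofactor [d / a] is coprime to [m / a], so by
    Gauss's lemma it divides [n]. *)
Lemma dvdn_mul_split (m n d : nat) : (0 < m)%N -> (d %| m * n)%N ->
  exists a b : nat, [/\ (a %| m)%N, (b %| n)%N & d = (a * b)%N].
Proof.
move=> m0 d_mn; pose g := gcdn d m; have g0 : (0 < g)%N by rewrite gcdn_gt0 m0 orbT.
have [g_d g_m] : (g %| d)%N /\ (g %| m)%N by rewrite dvdn_gcdl dvdn_gcdr.
exists g, (d %/ g)%N; split=> //; last by rewrite mulnC divnK.
have cop : coprime (d %/ g) (m %/ g).
  by rewrite /coprime -(eqn_pmul2r g0) muln_gcdl !divnK // mul1n.
by rewrite -(Gauss_dvdr _ cop) -(dvdn_pmul2r g0) divnK // mulnAC divnK.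
Qed.

Lemma ltr_nat_sqrt2 (R : realType) (a b : nat) :
  ((a%:R : R) < Num.sqrt (2%:R : R) * (b%:R : R)) -> (a ^ 2 < 2 * b ^ 2)%N.
Proof.
move=> ltab; rewrite -(ltr_nat R) natrM !natrX.
rewrite -[2%:R in ltRHS](@sqr_sqrtr R) ?ler0n // -exprMn.
by rewrite ltrXn2r // ?mulr_ge0 ?sqrtr_ge0 ?ler0n.
Qed.

Theorem theorem1p4 (R : realType) (h : nat -> int) (hdef : h_identity h)
    (n p1 p2 : nat) (p1_prime : prime p1) (p1_odd : odd p1)
    (p2_prime : prime p2) (p2_odd : odd p2)
    (p1_lt_p2 : (p1 < p2)%N)
    (p2_lt : (p2%:R : R) < Num.sqrt (2%:R : R) * (p1%:R : R))
    (hn : n = (p1 ^ 2 * p2 ^ 2)%N) :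
  h n = 3.
Proof.
have lt12 := ltr_nat_sqrt2 _ _ _ p2_lt.
have p1_gt2 : (2 < p1)%N by rewrite odd_prime_gt2.
have p2_gt2 : (2 < p2)%N by rewrite odd_prime_gt2.
have n_odd : odd n by rewrite hn oddM !oddX p1_odd p2_odd.
rewrite (h_odd _ _ hdef n_odd).
suff /perm_size -> : perm_eq [seq d <- divisors n | (n < 2 * d ^ 2 < 4 * n)%N]
    [:: p1 ^ 2; p1 * p2; p2 ^ 2]%N by [].
have p1sq_gt2 : (2 < p1 ^ 2)%N by rewrite -mulnn (leq_trans _ (leq_mul p1_gt2 p1_gt2)).
have p2sq_gt2 : (2 < p2 ^ 2)%N by rewrite -mulnn (leq_trans _ (leq_mul p2_gt2 p2_gt2)).
have p1sq_lt : (p1 ^ 2 < p1 * p2)%N by rewrite -mulnn ltn_pmul2l //; lia.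
have p2sq_gt : (p1 * p2 < p2 ^ 2)%N by rewrite -mulnn ltn_pmul2r //; lia.
apply: uniq_perm; first by rewrite filter_uniq ?divisors_uniq.
  rewrite /= !inE !negb_or (ltn_eqF p1sq_lt) (ltn_eqF p2sq_gt).
  by rewrite (ltn_eqF (ltn_trans p1sq_lt p2sq_gt)).
move=> d; rewrite mem_filter -dvdn_divisors ?odd_gt0 // !inE.
apply/idP/idP => [/andP[/andP[lb ub]]|].
  rewrite hn => /dvdn_mul_split; rewrite expn_gt0 (ltnW (ltnW p1_gt2)).
  move=> /(_ isT)[_ [_ [/(dvdn_pfactor _ _ p1_prime)[i i2 ->]
    /(dvdn_pfactor _ _ p2_prime)[j j2 ->] dE]]].
  (* With [A = p1^2] and [B = p2^2] as atoms, each of the six divisors outside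
     the window contradicts one of its bounds because [A] and [B] exceed 2. *)
  move: lb ub; rewrite {}dE hn.
  case: i i2 => [|[|[|//]]] _; case: j j2 => [|[|[|//]]] _;
    rewrite ?expn0 ?expn1 ?mul1n ?muln1 ?eqxx ?orbT // ?expnMn ?exp1n;
    move: p1sq_gt2 p2sq_gt2; clear; set A := (p1 ^ 2)%N; set B := (p2 ^ 2)%N;
    rewrite -?mulnn; nia.
have sq12 : (p1 ^ 2 < p2 ^ 2)%N := ltn_trans p1sq_lt p2sq_gt.
case/or3P=> /eqP ->; rewrite hn;
  [rewrite dvdn_mulr // | rewrite dvdn_mul ?dvdn_exp // | rewrite dvdn_mull //];
  rewrite andbT ?expnMn;
  move: p1sq_gt2 p2sq_gt2 lt12 sq12; clear; set A := (p1 ^ 2)%N; set B := (p2 ^ 2)%N;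
  rewrite -?mulnn; nia.
Qed.
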